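(* Let $v>1$ be an integer, let $F$ be an absolutely continuous distribution function of a non-negative random variable $X$ with $E(X)<\infty$, and let $X_1,X_2,\dots$ be i.i.d. with distribution function $F$. Let $$GIM(v)=\frac{E\big(\max(X_1,\dots,X_v)-\min(X_1,\dots,X_v)\big)}{E\big(\max(X_1,\dots,X_v)+\min(X_1,\dots,X_v)\big)},$$ and for $n\ge v$ let $\widehat{GIM}(v)=U_1/U_2$, where $$U_1=\binom{n}{v}^{-1}\sum_{1\le i_1<\cdots<i_v\le n}\big(\max(X_{i_1},\dots,X_{i_v})-\min(X_{i_1},\dots,X_{i_v})\big),$$ $$U_2=\binom{n}{v}^{-1}\sum_{1\le i_1<\cdots<i_v\le n}\big(\max(X_{i_1},\dots,X_{i_v})+\min(X_{i_1},\dots,X_{i_v})\big).$$ Then, as $n\to\infty$, $\widehat{GIM}(v)$ is a consistent estimator of $GIM(v)$.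
   Context: ''Consistent'' means convergence in probability to the estimated quantity as $n\to\infty$. $GIM(v)$ is the generalized inequality measure of order $v$. *)

(* Defs.v *)
From HB Require Import structures.
From mathcomp Require Import all_boot all_order all_algebra.
From mathcomp Require Import finmap.
From mathcomp Require Import all_classical all_reals all_analysis.

Set Implicit Arguments.
Unset Strict Implicit.
Unset Printing Implicit Defensive.

Import Order.TTheory GRing.Theory Num.Theory.
Import numFieldNormedType.Exports.

Local Open Scope classical_set_scope.
Local Open Scope ring_scope.

(* Absolute continuity of a function on the whole real line. Degenerate
   intervals (a i = b i) are allowed; they contribute nothing to either sum. *)
Definition absolutely_continuous (R : realType) (F : R -> R) : Prop :=
  forall e : R, 0 < e -> exists2 delta : R, 0 < delta &
    forall (n : nat) (a b : 'I_n -> R),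
      (forall i, a i <= b i) ->
      trivIset [set: 'I_n] (fun i => `]a i, b i[%classic) ->
      \sum_(i < n) (b i - a i) < delta ->
      \sum_(i < n) `|F (b i) - F (a i)| < e.

Definition mutually_independent d (T : measurableType d) (R : realType)
    (P : probability T R) (I : choiceType) (X : I -> {RV P >-> R}) : Prop :=
  forall (J : {fset I}) (B : I -> set R),
    (forall i, i \in J -> measurable (B i)) ->
    P (\bigcap_(i in [set` J]) (X i @^-1` B i)) =
    (\prod_(i <- J) P (X i @^-1` B i))%E.

Definition cvg_in_probability d (T : measurableType d) (R : realType)
    (P : probability T R) (Y : nat -> T -> R) (l : R) : Prop :=
  forall e : R, 0 < e ->
    (fun n => P [set w | e < `|Y n w - l|]) @ \oo --> 0%E.

Section GIM.
Variable R : realType.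

(* The extrema of a nonempty sequence; starting the iteration at the first
   element makes the default value irrelevant unless s is empty. *)
Definition seq_max (s : seq R) : R := \big[Num.max/head 0 s]_(y <- s) y.
Definition seq_min (s : seq R) : R := \big[Num.min/head 0 s]_(y <- s) y.

Definition max_minus_min (s : seq R) : R := seq_max s - seq_min s.
Definition max_plus_min (s : seq R) : R := seq_max s + seq_min s.

(* U-statistic with kernel h of degree v on the first n terms of x; the
   strictly increasing v-tuples of 'I_n encode 1 <= i_1 < ... < i_v <= n,
   shifted to start at 0. *)
Definition U_stat (v : nat) (h : seq R -> R) (n : nat) (x : nat -> R) : R :=
  'C(n, v)%:R^-1 *
  \sum_(t : v.-tuple 'I_n | sorted ltn (map val t))
     h [seq x (nat_of_ord i) | i <- t].

(* Only meaningful for v <= n (for n < v the quotient is 0 / 0 = 0). *)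
Definition GIM_hat (v n : nat) (x : nat -> R) : R :=
  U_stat v max_minus_min n x / U_stat v max_plus_min n x.

Definition GIM d (T : measurableType d) (P : probability T R) (v : nat)
    (X : nat -> {RV P >-> R}) : R :=
  fine 'E_P[fun w => max_minus_min (mkseq (fun i => X i w) v)] /
  fine 'E_P[fun w => max_plus_min (mkseq (fun i => X i w) v)].

End GIM.

(* Main.v *)
Require Import Defs.
From HB Require Import structures.
From mathcomp Require Import all_boot all_order all_algebra.
From mathcomp Require Import finmap ring lra.
From mathcomp Require Import all_classical all_reals all_analysis measurable_realfun.

Import Order.TTheory GRing.Theory Num.Theory.
Import numFieldNormedType.Exports.

Local Open Scope classical_set_scope.
Local Open Scope ring_scope.

(* Both extrema are U-statistics with an integrable kernel picking an entry of
   the sample. Rounding each observation up to a finite grid changes such a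
   U-statistic little in L1, uniformly in n, and turns max and min into finite
   linear combinations of kernels 1 - \prod_i 1[x_i <= c] and \prod_i 1[x_i > c].
   The U-statistic of a product of indicators only depends on the number N of
   sample points in a set A: it equals 'C(N, v) / 'C(n, v), so its convergence to
   P(A) ^ v follows from the weak law of large numbers for N / n. Hence numerator
   and denominator converge in L1, and the limit of the denominator is positive
   because an absolutely continuous law has no atom at 0. *)

(** * Counting increasing index tuples, and ratios of binomial coefficients *)

(** A strictly increasing tuple is determined by its set of entries, so sending [t] to that set is a
    bijection onto the subsets of [B] with [v] elements; [enum] provides the preimages. *)
Lemma card_ltn_sorted_tuples_all (v n : nat) (B : {set 'I_n}) :
  #|[set t : v.-tuple 'I_n | sorted ltn (map val t) & all (mem B) t]|
  = 'C(#|B|, v).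
Proof.
have sortedE (A : {set 'I_n}) : sorted ltn (map val (enum A)).
  rewrite sorted_map /enum_mem sorted_filter//; first by move=> ? ? ?; exact: ltn_trans.
  by rewrite -enumT -sorted_map val_enum_ord iota_ltn_sorted.
rewrite -cards_draws -(@card_in_imset _ _ (fun t : v.-tuple 'I_n => [set i in t])).
  apply: eq_card => A; apply/imsetP/idP => [[t]|].
    rewrite !inE => /andP[st /allP tB] ->; apply/andP; split.
      by apply/fintype.subsetP => i; rewrite inE => /tB.
    rewrite cardsE (card_uniqP _) ?size_tuple// -(map_inj_uniq val_inj).
    exact: (sorted_uniq ltn_trans ltnn).
  rewrite inE => /andP[/fintype.subsetP AB /eqP Av].
  have sz : size (enum A) == v by rewrite -cardE Av.
  exists (Tuple sz); last by apply/setP => i; rewrite inE mem_enum.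
  by rewrite inE sortedE; apply/allP => i; rewrite mem_enum => /AB.
move=> t u; rewrite !inE => /andP[st _] /andP[su _] /setP tu; apply/val_inj/(inj_map val_inj).
apply: (irr_sorted_eq ltn_trans ltnn) => // y.
by apply/mapP/mapP => -[x xt ->]; exists x => //; have := tu x; rewrite !inE xt.
Qed.

(** Telescoping: the factors are exchanged one at a time, and the remaining factors have norm at
    most [1]. *)
Lemma norm_prodB_le1 (R : realFieldType) (m : nat) (a b : nat -> R) :
  (forall i, 0 <= a i <= 1) -> (forall i, 0 <= b i <= 1) ->
  `|\prod_(i < m) a i - \prod_(i < m) b i| <= \sum_(i < m) `|a i - b i|.
Proof.
move=> a01 b01.
elim: m => [|m IH]; first by rewrite !big_ord0 subrr normr0.
rewrite !big_ord_recr /=.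
have -> : \prod_(i < m) a i * a m - \prod_(i < m) b i * b m =
  (\prod_(i < m) a i - \prod_(i < m) b i) * a m + \prod_(i < m) b i * (a m - b m) by ring.
rewrite (le_trans (ler_normD _ _))// !normrM lerD//.
  rewrite (le_trans _ IH)// ler_piMr// ger0_norm; by case/andP: (a01 m).
rewrite ler_piMl// ger0_norm; last by apply: prodr_ge0 => i _; case/andP: (b01 i).
by apply: prodr_ile1 => i _.
Qed.

(** The ratio is the product of the [v] factors [(k - i) / (n - i)]. Each is compared with [p]
    through [k / n]; passing from one fraction to the other costs at most [i / (n - i)]. *)
Lemma binomial_ratio_power (R : realFieldType) (v n k : nat) (p : R) :
  (v < n)%N -> (k <= n)%N -> 0 <= p <= 1 ->
  `|'C(k, v)%:R / 'C(n, v)%:R - p ^+ v| <=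
  v%:R * (`|k%:R / n%:R - p| + v%:R / (n - v)%:R).
Proof.
move=> vn kn p01.
have nv0 : (0 < n - v)%N by rewrite subn_gt0.
have n0 : (0 < n)%N by exact: leq_ltn_trans vn.
(* The product comparison asks for bounds in [[0, 1]] at every natural index; the value [0] from [v]
   on provides them there. *)
pose a i : R := if (i < v)%N then (k - i)%:R / (n - i)%:R else 0.
have -> : 'C(k, v)%:R / 'C(n, v)%:R = \prod_(i < v) a i.
  have f0 : v`!%:R != 0 :> R by rewrite pnatr_eq0 -lt0n fact_gt0.
  transitivity ((k ^_ v)%:R / (n ^_ v)%:R : R).
    by rewrite -!bin_ffact !natrM -mulf_div divff// mulr1.
  rewrite !ffact_prod !natr_prod -prodf_div.
  by apply: eq_bigr => i _; rewrite /a ltn_ord.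
rewrite -[p ^+ v](_ : \prod_(i < v) p = _); last by rewrite prodr_const card_ord.
have a01 i : 0 <= a i <= 1.
  rewrite /a; case: ifP => iv; last by rewrite lexx ler01.
  have ni : (0 < n - i)%N by rewrite subn_gt0 (ltn_trans iv).
  by rewrite divr_ge0//= ler_pdivrMr ?ltr0n// mul1r ler_nat leq_sub2r.
rewrite (le_trans (@norm_prodB_le1 _ _ _ (fun=> p) a01 (fun=> p01)))//.
have sumE (c : R) : v%:R * c = \sum_(i < v) c by rewrite sumr_const card_ord mulr_natl.
rewrite sumE ler_sum// => i _.
have -> : a i - p = (k%:R / n%:R - p) + (a i - k%:R / n%:R) by ring.
rewrite (le_trans (ler_normD _ _))// lerD2l /a ltn_ord.
have iv := ltn_ord i.
have ni : (0 < n - i)%N by rewrite subn_gt0 (ltn_trans iv).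
have niR : 0 < (n - i)%:R :> R by rewrite ltr0n.
have nR : 0 < n%:R :> R by rewrite ltr0n.
have nvR : 0 < (n - v)%:R :> R by rewrite ltr0n.
have le1 : i%:R / (n - i)%:R <= v%:R / (n - v)%:R :> R.
  rewrite ler_pM ?invr_ge0 ?ler0n ?ler_nat 1?ltnW// lef_pV2 ?posrE// ler_nat.
  by rewrite leq_sub2l// ltnW.
rewrite (le_trans _ le1)//.
have iltn : (i <= n)%N by rewrite ltnW// (ltn_trans iv).
have nE : (n - i)%:R = n%:R - i%:R :> R by rewrite natrB.
have knR : k%:R <= n%:R :> R by rewrite ler_nat.
(* For [k < i] the truncated [k - i] is [0] and the error is [k / n]. Otherwise the error is
   [i / (n - i)] times [(n - k) / n], which is at most [1]. *)
have [ki|ik] := ltnP k i.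
  rewrite (eqP (ltnW ki)) mul0r sub0r normrN ger0_norm ?divr_ge0//.
  rewrite ler_pM ?invr_ge0 ?ler0n ?ler_nat 1?ltnW// lef_pV2 ?posrE//.
  by rewrite ler_nat leq_subr.
have -> : (k - i)%:R / (n - i)%:R - k%:R / n%:R =
   - (i%:R * ((n%:R - k%:R) / n%:R) / (n - i)%:R) :> R.
  rewrite natrB// nE; field; rewrite -nE; apply/andP; split; exact: lt0r_neq0.
rewrite normrN ger0_norm; last by rewrite divr_ge0// ?mulr_ge0 ?divr_ge0// ?subr_ge0.
rewrite ler_pM2r ?invr_gt0// ler_piMr// ler_pdivrMr// mul1r lerBlDr lerDl//.
Qed.

(** * U-statistics as sums over increasing sequences of naturals *)

(** The entries are plain naturals instead of elements of ['I_n], so that conditions on a kernel can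
    be stated over [seq nat], once for all sample sizes. *)
Definition ltn_seqs (v n : nat) : seq (seq nat) :=
  [seq map val t | t : v.-tuple 'I_n <- index_enum _ & sorted ltn (map val t)].

Lemma size_mem_ltn_seqs (v n : nat) (t : seq nat) : t \in ltn_seqs v n -> size t = v.
Proof. by move=> /mapP[u _ ->]; rewrite size_map size_tuple. Qed.

Lemma U_statE (R : realType) (v n : nat) (h : seq R -> R) (x : nat -> R) :
  U_stat v h n x = 'C(n, v)%:R^-1 * \sum_(t <- ltn_seqs v n) h (map x t).
Proof.
congr (_ * _); rewrite /ltn_seqs big_map big_filter.
by apply: eq_bigr => t _; rewrite -map_comp.
Qed.

Lemma U_statDM (R : realType) (v n : nat) (h1 h2 : seq R -> R) (c : R) (x : nat -> R) :
  U_stat v (fun s => h1 s + c * h2 s) n x = U_stat v h1 n x + c * U_stat v h2 n x.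
Proof.
by rewrite !U_statE big_split/= -mulr_sumr mulrDr; congr (_ + _); ring.
Qed.

(** The sum counts the increasing tuples drawn from the set of indices [i] with [A (x i)]. Taking
    [predT] for [A] gives the number of terms of a U-statistic. *)
Lemma sum_ltn_seqs_all (R : realType) (v n : nat) (A : pred R) (x : nat -> R) :
  \sum_(t <- ltn_seqs v n) (all A (map x t))%:R = 'C(\sum_(i < n) A (x i), v)%:R :> R.
Proof.
have -> : (\sum_(i < n) A (x i) = #|[set i : 'I_n | A (x i)]%SET|)%N.
  by rewrite -sum1dep_card [RHS]big_mkcond/=; apply: eq_bigr => i _; case: (A _).
rewrite -card_ltn_sorted_tuples_all -sum1dep_card natr_sum.
rewrite /ltn_seqs big_map big_filter big_mkcond [RHS]big_mkcond/=; apply: eq_bigr => t _.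
rewrite -map_comp all_map; case: sorted => //=.
have -> : all (mem [set i : 'I_n | A (x i)]%SET) t = all (preim (x \o val) A) t.
  by apply: eq_all => i /=; rewrite inE.
by case: all.
Qed.

(** * Convergence of U-statistics in L1 and its closure properties *)

Section L1_consistency.
Context d (T : measurableType d) (R : realType) (P : probability T R).
Variable X : nat -> T -> R.
Local Notation E f := (\int[P]_w (f w)%:E)%E.
Local Notation sample h t := (fun w => h [seq X i w | i <- t]).

Lemma ge0_expectation_sum (I : Type) (s : seq I) (f : I -> T -> R) :
  (forall i, measurable_fun setT (f i)) -> (forall i w, 0 <= f i w) ->
  E (fun w => \sum_(i <- s) f i w) = (\sum_(i <- s) E (f i))%E.
Proof.
move=> mf f0; under eq_integral do rewrite -sumEFin.
rewrite ge0_integral_sum// => [i|i w _]; last by rewrite lee_fin.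
exact/measurable_EFinP.
Qed.

Lemma ge0_expectationM (c : R) (f : T -> R) :
  measurable_fun setT f -> (forall w, 0 <= f w) -> 0 <= c ->
  E (fun w => c * f w) = (c%:E * E f)%E.
Proof.
move=> mf f0 c0; under eq_integral do rewrite EFinM.
apply: ge0_integralZl_EFin => // [w _|]; first by rewrite lee_fin.
exact/measurable_EFinP.
Qed.

Lemma ge0_expectationD (f g : T -> R) :
  measurable_fun setT f -> (forall w, 0 <= f w) ->
  measurable_fun setT g -> (forall w, 0 <= g w) ->
  E (fun w => f w + g w) = (E f + E g)%E.
Proof.
move=> mf f0 mg g0; under eq_integral do rewrite EFinD.
apply: ge0_integralD => // [w _||w _|]; rewrite ?lee_fin//; exact/measurable_EFinP.
Qed.

Lemma ge0_expectation_le (f g : T -> R) :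
  measurable_fun setT f -> (forall w, 0 <= f w) ->
  measurable_fun setT g -> (forall w, f w <= g w) ->
  (E f <= E g)%E.
Proof.
move=> mf f0 mg fg; apply: ge0_le_integral => // [w _|||w _]; rewrite ?lee_fin//; exact/measurable_EFinP.
Qed.

Lemma ge0_expectation_cst (c : R) : E (fun=> c) = c%:E.
Proof. by rewrite integral_cst//= probability_setT mule1. Qed.

Lemma measurable_U_stat (v n : nat) (h : seq R -> R) :
  (forall t, measurable_fun setT (sample h t)) ->
  measurable_fun setT (fun w => U_stat v h n (X ^~ w)).
Proof.
move=> mh.
rewrite (_ : (fun w => _) = fun w => 'C(n, v)%:R^-1 *
    \sum_(t <- ltn_seqs v n) h [seq X i w | i <- t]).
  by apply: measurable_funM => //; exact: measurable_sum.
by apply/funext => w; rewrite U_statE.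
Qed.

(** A U-statistic is an average over index sequences of size [v], so the triangle inequality passes
    a bound on each term to the whole, with a constant independent of [n]. *)
Lemma L1_U_statB_le (v n : nat) (h1 h2 : seq R -> R) (c : R) :
  (v <= n)%N ->
  (forall t, measurable_fun setT (sample h1 t)) ->
  (forall t, measurable_fun setT (sample h2 t)) ->
  (forall t, size t = v ->
    (E (fun w => `|h1 [seq X i w | i <- t] - h2 [seq X i w | i <- t]|)
       <= c%:E)%E) ->
  (E (fun w => `|U_stat v h1 n (X ^~ w) - U_stat v h2 n (X ^~ w)|) <= c%:E)%E.
Proof.
move=> vn mh1 mh2 hc.
have C0 : 0 < 'C(n, v)%:R :> R by rewrite ltr0n bin_gt0.
pose D t w := `|h1 [seq X i w | i <- t] - h2 [seq X i w | i <- t]|.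
have mD t : measurable_fun setT (D t).
  by apply: measurableT_comp => //; exact: measurable_funB.
have mS : measurable_fun setT (fun w => \sum_(t <- ltn_seqs v n) D t w).
  exact: measurable_sum.
apply: (@le_trans _ _ (E (fun w => 'C(n, v)%:R^-1 * \sum_(t <- ltn_seqs v n) D t w))).
  apply: ge0_expectation_le => //.
  - by apply: measurableT_comp => //; apply: measurable_funB; exact: measurable_U_stat.
  - exact: measurable_funM.
  - move=> w; rewrite !U_statE -mulrBr normrM gtr0_norm ?invr_gt0//.
    rewrite ler_pM2l ?invr_gt0// -sumrB; exact: ler_norm_sum.
rewrite ge0_expectationM//; last first.
  by move=> w; apply: sumr_ge0 => t _; exact: normr_ge0.
rewrite ge0_expectation_sum//; last by move=> t w; exact: normr_ge0.
have le : (\sum_(t <- ltn_seqs v n) E (D t) <= ('C(n, v)%:R * c)%:E)%E.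
  rewrite big_seq; apply: (@le_trans _ _ (\sum_(t <- ltn_seqs v n | t \in ltn_seqs v n) c%:E)%E).
    by apply: lee_sum => t /size_mem_ltn_seqs; exact: hc.
  rewrite -big_seq sumEFin lee_fin.
  (* The number of index sequences is ['C(n, v)], which cancels the normalization. *)
  have := sum_ltn_seqs_all R v n predT (fun=> 0).
  under eq_bigr do rewrite all_predT.
  rewrite sum1_card card_ord => <-; rewrite mulr_suml.
  by under [leRHS]eq_bigr do rewrite mul1r.
apply: (le_trans (lee_wpmul2l _ le)); first by rewrite lee_fin invr_ge0 ltW.
by rewrite -EFinM mulrA mulVf ?mul1r// gt_eqF.
Qed.

(** Integrability is asked for all [t], of any size and with possible repetitions, so that
    measurability follows without side conditions. As [mkseq] maps over [iota 0 v], it also covers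
    the target expectation, which is therefore finite, and [fine] loses nothing. Convergence in L1
    is the mode that combines well with linear operations and with approximation of kernels. *)
Definition L1_consistent (v : nat) (h : seq R -> R) : Prop :=
  (forall t, P.-integrable setT (EFin \o sample h t)) /\
  forall e, 0 < e -> \forall n \near \oo,
    (E (fun w => `|U_stat v h n (X ^~ w)
       - fine (E (fun w => h (mkseq (X ^~ w) v)))|) <= e%:E)%E.

Lemma integrable_kernel_measurable (h : seq R -> R) :
  (forall t, P.-integrable setT (EFin \o sample h t)) ->
  forall t, measurable_fun setT (sample h t).
Proof. by move=> ih t; apply/measurable_EFinP; exact: measurable_int (ih t). Qed.

(** This single closure rule yields sums, differences and, by iteration, all finite linear
    combinations of kernels. *)
Lemma L1_consistentDM (v : nat) (h1 h2 : seq R -> R) (c : R) :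
  L1_consistent v h1 -> L1_consistent v h2 ->
  L1_consistent v (fun s => h1 s + c * h2 s).
Proof.
move=> [i1 c1] [i2 c2].
have mU1 n := measurable_U_stat v n _ (integrable_kernel_measurable _ i1).
have mU2 n := measurable_U_stat v n _ (integrable_kernel_measurable _ i2).
split => [t|e e0].
  rewrite [X in P.-integrable _ X](_ : _ = (EFin \o sample h1 t) \+
     (fun w => c%:E * (EFin \o sample h2 t) w))%E; last by apply/funext.
  by apply: integrableD => //; exact: integrableZl.
set th1 := fine (E (fun w => h1 (mkseq (X ^~ w) v))) in c1.
set th2 := fine (E (fun w => h2 (mkseq (X ^~ w) v))) in c2.
have f1 : E (fun w => h1 (mkseq (X ^~ w) v)) \is a fin_num.
  by apply: integrable_fin_num => //; exact: i1.
have f2 : E (fun w => h2 (mkseq (X ^~ w) v)) \is a fin_num.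
  by apply: integrable_fin_num => //; exact: i2.
have -> : fine (E (fun w => h1 (mkseq (X ^~ w) v) + c * h2 (mkseq (X ^~ w) v)))
    = th1 + c * th2.
  under eq_integral do rewrite EFinD EFinM.
  rewrite integralD//; [|exact: i1|by apply: integrableZl => //; exact: i2].
  rewrite integralZl//; last exact: i2.
  by rewrite fineD ?fineM ?fin_numM.
have e1 : 0 < e / 2 by rewrite divr_gt0.
(* The [1 +] keeps the divisor positive when [c = 0]. *)
have e2 : 0 < e / 2 / (1 + `|c|) by rewrite divr_gt0// ltr_pwDl.
near=> n.
have h1n : (E (fun w => `|U_stat v h1 n (X ^~ w) - th1|) <= (e / 2)%:E)%E.
  by near: n; exact: c1.
have h2n : (E (fun w => `|U_stat v h2 n (X ^~ w) - th2|) <= (e / 2 / (1 + `|c|))%:E)%E.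
  by near: n; exact: c2.
have m1 : measurable_fun setT (fun w => `|U_stat v h1 n (X ^~ w) - th1|).
  by apply: measurableT_comp => //; exact: measurable_funB.
have m2 : measurable_fun setT (fun w => `|U_stat v h2 n (X ^~ w) - th2|).
  by apply: measurableT_comp => //; exact: measurable_funB.
apply: (@le_trans _ _ (E (fun w => `|U_stat v h1 n (X ^~ w) - th1|
   + `|c| * `|U_stat v h2 n (X ^~ w) - th2|))).
  apply: ge0_expectation_le => //.
  - apply: measurableT_comp => //; apply: measurable_funB => //.
    under eq_fun do rewrite U_statDM.
    by apply: measurable_funD => //; exact: measurable_funM.
  - by apply: measurable_funD => //; exact: measurable_funM.
  - move=> w; rewrite U_statDM -normrM (le_trans _ (ler_normD _ _))//.
    by rewrite le_eqVlt; apply/orP; left; apply/eqP; congr `|_|; ring.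
rewrite ge0_expectationD//; last exact: measurable_funM.
rewrite ge0_expectationM//.
rewrite [e in leRHS]splitr EFinD leeD//.
apply: (le_trans (lee_wpmul2l _ h2n)); first by rewrite lee_fin.
rewrite -EFinM lee_fin mulrCA ler_piMr ?(ltW e1)// ler_pdivrMr ?ltr_pwDl// mul1r.
by rewrite lerDr.
Unshelve. all: by end_near. Qed.

(** Three errors of size [e / 3]: between the two U-statistics, uniformly in [n]; between the
    U-statistic of [h'] and its limit; and between the two expectations. *)
Lemma L1_consistent_approx (v : nat) (h : seq R -> R) :
  (forall t, P.-integrable setT (EFin \o sample h t)) ->
  (forall e, 0 < e -> exists2 h', L1_consistent v h' & forall t, size t = v ->
    (E (fun w => `|h [seq X i w | i <- t] - h' [seq X i w | i <- t]|) <= e%:E)%E) ->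
  L1_consistent v h.
Proof.
move=> ih happ; split => // e e0.
have e3 : 0 < e / 3 by rewrite divr_gt0.
have [h' [ih' ch'] hh'] := happ _ e3.
have mh := integrable_kernel_measurable _ ih.
have mh' := integrable_kernel_measurable _ ih'.
have mU n := measurable_U_stat v n _ mh.
have mU' n := measurable_U_stat v n _ mh'.
set th := fine (E (fun w => h (mkseq (X ^~ w) v))).
set th' := fine (E (fun w => h' (mkseq (X ^~ w) v))) in ch'.
have f1 : E (fun w => h (mkseq (X ^~ w) v)) \is a fin_num.
  by apply: integrable_fin_num => //; exact: ih.
have f2 : E (fun w => h' (mkseq (X ^~ w) v)) \is a fin_num.
  by apply: integrable_fin_num => //; exact: ih'.
(* The kernel bound at the index sequence [iota 0 v] controls the difference of the expectations. *)
have thth' : `|th' - th| <= e / 3.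
  rewrite -lee_fin distrC; apply: le_trans (hh' (iota 0 v) (size_iota _ _)).
  have -> : `|th - th'|%:E = `| \int[P]_w (h (mkseq (X ^~ w) v) - h' (mkseq (X ^~ w) v))%:E|%E.
    under eq_integral do rewrite EFinB.
    rewrite integralB//; [|exact: ih|exact: ih'].
    by rewrite -(fineK f1) -(fineK f2).
  apply: (le_trans (le_abse_integral _ _ _)) => //.
  by apply/measurable_EFinP; apply: measurable_funB; [exact: mh|exact: mh'].
near=> n.
have vn : (v <= n)%N by near: n; exact: nbhs_infty_ge.
have ch'n : (E (fun w => `|U_stat v h' n (X ^~ w) - th'|) <= (e / 3)%:E)%E.
  by near: n; exact: ch'.
have hn : (E (fun w => `|U_stat v h n (X ^~ w) - U_stat v h' n (X ^~ w)|) <= (e / 3)%:E)%E.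
  exact: L1_U_statB_le.
have m1 : measurable_fun setT (fun w => `|U_stat v h n (X ^~ w) - U_stat v h' n (X ^~ w)|).
  by apply: measurableT_comp => //; exact: measurable_funB.
have m2 : measurable_fun setT (fun w => `|U_stat v h' n (X ^~ w) - th'|).
  by apply: measurableT_comp => //; exact: measurable_funB.
apply: (@le_trans _ _ (E (fun w => (`|U_stat v h n (X ^~ w) - U_stat v h' n (X ^~ w)| +
   `|U_stat v h' n (X ^~ w) - th'|) + e / 3))).
  apply: ge0_expectation_le => //.
  - by apply: measurableT_comp => //; exact: measurable_funB.
  - by apply: measurable_funD => //; exact: measurable_funD.
  - move=> w; rewrite (le_trans _ (lerD (lexx _) thth'))//.
    rewrite (le_trans _ (lerD (ler_normD _ _) (lexx _)))//.
    rewrite (le_trans _ (ler_normD _ _))//.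
    by rewrite le_eqVlt; apply/orP; left; apply/eqP; congr `|_|; ring.
rewrite ge0_expectationD//; last 2 first.
- exact: measurable_funD.
- by move=> w; exact: ltW.
rewrite ge0_expectationD// ge0_expectation_cst.
rewrite (le_trans (leeD (leeD hn ch'n) (lexx _)))// -!EFinD lee_fin.
by lra.
Unshelve. all: by end_near. Qed.

End L1_consistency.

Arguments L1_consistent {d T R} P X v h.

(** * Products of indicators: a weak law through the variance of a count *)

Section indicator_kernel.
Context d (T : measurableType d) (R : realType) (P : probability T R).
Variables (X : nat -> T -> R) (A : pred R) (p : R).
Hypothesis mX : forall i, measurable_fun setT (X i).
Hypothesis mA : measurable [set x | A x].
Local Notation E f := (\int[P]_w (f w)%:E)%E.
Local Notation kernel s := ((all A s)%:R : R).
(** Independence and the common law of the observations enter this section only through this product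
    formula. *)
Hypothesis Eall : forall t : seq nat, uniq t ->
  E (fun w => kernel [seq X i w | i <- t]) = (p ^+ size t)%:E.

Let measurable_all (t : seq nat) :
  measurable_fun setT (fun w => kernel [seq X i w | i <- t]).
Proof.
elim: t => [|i t IH] /=; first exact: measurable_cst.
rewrite (_ : (fun _ => _) =
    fun w => (\1_[set x | A x] \o X i) w * kernel [seq X i w | i <- t]); last first.
  by apply/funext => w; rewrite /= indicE mem_setE -mulnb natrM.
apply: measurable_funM => //; apply: measurableT_comp => //.
Qed.

Let integrable_all (t : seq nat) :
  P.-integrable setT (EFin \o (fun w => kernel [seq X i w | i <- t])).
Proof.
apply: (@le_integrable _ _ _ _ _ _ _ (cst 1%E)) => //.
- exact/measurable_EFinP.
- by move=> w _; rewrite /= lee_fin !normr1 ger0_norm// lern1 leq_b1.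
- exact: finite_measure_integrable_cst.
Qed.

Let p01 : 0 <= p <= 1.
Proof.
have := Eall [:: 0%N] erefl; rewrite expr1 => Ep.
rewrite -!lee_fin -Ep; apply/andP; split.
  by apply: integral_ge0 => w _; rewrite lee_fin.
rewrite -(ge0_expectation_cst _ _ _ P 1); apply: ge0_expectation_le.
- exact: (measurable_all [:: 0%N]).
- by move=> w; exact: ler0n.
- exact: measurable_cst.
- by move=> w; rewrite lern1 leq_b1.
Qed.

Let EA i : E (fun w => (A (X i w))%:R) = p%:E.
Proof.
rewrite -[p]expr1 -(Eall [:: i] erefl).
by apply: eq_integral => w _; rewrite /= andbT.
Qed.

Let N n w := \sum_(i < n) (A (X i w))%:R : R.

Let mN n : measurable_fun setT (N n).
Proof.
apply: measurable_sum => i; have := measurable_all [:: val i].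
by rewrite /=; under eq_fun do rewrite andbT.
Qed.

Let EN n : E (N n) = (n%:R * p)%:E.
Proof.
rewrite ge0_expectation_sum//; last first.
  by move=> i; have := measurable_all [:: val i]; rewrite /=; under eq_fun do rewrite andbT.
under eq_bigr do rewrite EA.
by rewrite sumEFin sumr_const card_ord mulr_natl.
Qed.

(** The square expands into a sum over pairs of indices. A diagonal pair contributes [p], bounded
    crudely by [1 + p ^+ 2]; a pair of distinct indices contributes [p ^+ 2] by [Eall]. The
    quadratic part is then exactly the one that cancels in the variance. *)
Let EN2 n : (E (fun w => N n w ^+ 2) <= (n%:R + n%:R ^+ 2 * p ^+ 2)%:E)%E.
Proof.
have [p0 p1] := andP p01.
have -> : E (fun w => N n w ^+ 2) = E
    (fun w => \sum_(i < n) \sum_(j < n) kernel [seq X k w | k <- [:: val i; val j]]).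
  apply: eq_integral => w _; congr _%:E; rewrite expr2 /N mulr_suml; apply: eq_bigr => i _.
  by rewrite mulr_sumr; apply: eq_bigr => j _; rewrite /= andbT -mulnb natrM.
rewrite ge0_expectation_sum; last 2 first.
- by move=> i; apply: measurable_sum => j; exact: measurable_all.
- by move=> i w; apply: sumr_ge0 => j _; exact: ler0n.
apply: (@le_trans _ _ (\sum_(i < n) (1 + n%:R * p ^+ 2)%:E)%E); last first.
  by rewrite sumEFin lee_fin sumr_const card_ord -mulr_natl; nra.
apply: lee_sum => i _; rewrite ge0_expectation_sum; last 2 first.
- by move=> j; exact: measurable_all.
- by move=> j w; exact: ler0n.
apply: (@le_trans _ _ (\sum_(j < n) ((j == i)%:R + p ^+ 2)%:E)%E).
  apply: lee_sum => j _; have [->|ji] := eqVneq j i.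
    have -> : E (fun w => kernel [seq X k w | k <- [:: val i; val i]]) = p%:E.
      by rewrite -(EA i); apply: eq_integral => w _; rewrite /= andbT andbb.
    by rewrite lee_fin /= -[1%:R]/(1 : R); nra.
  rewrite (Eall [:: val i; val j]) ?lee_fin ?mulr0n ?add0r//=.
  by rewrite inE andbT eq_sym.
rewrite sumEFin lee_fin big_split/= sumr_const card_ord -[X in _ + X <= _]mulr_natl lerD2r.
by rewrite (bigD1 i)//= eqxx big1 ?addr0// => j /negPf ->.
Qed.

Let variance_le n : (E (fun w => (N n w - n%:R * p) ^+ 2) <= n%:R%:E)%E.
Proof.
have [p0 p1] := andP p01.
have N0 w : 0 <= N n w by apply: sumr_ge0 => i _; exact: ler0n.
have np0 : 0 <= n%:R * p by rewrite mulr_ge0.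
have m1 : measurable_fun setT (fun w => (N n w - n%:R * p) ^+ 2).
  by apply: measurable_funX; exact: measurable_funB.
have m2 : measurable_fun setT (fun w => N n w ^+ 2) by exact: measurable_funX.
(* Adding twice [(n%:R * p) ^+ 2], the expectation of [2 n p N], to both sides avoids the negative
   cross term, so only integrals of non-negative functions are added. *)
have : (E (fun w => (N n w - n%:R * p) ^+ 2) + ((n%:R * p) ^+ 2 *+ 2)%:E
   <= n%:R%:E + ((n%:R * p) ^+ 2 *+ 2)%:E)%E.
  have -> : ((n%:R * p) ^+ 2 *+ 2)%:E = E (fun w => (n%:R * p *+ 2) * N n w).
    rewrite ge0_expectationM ?EN ?mulrn_wge0// -EFinM; congr _%:E; ring.
  rewrite -ge0_expectationD//; last 3 first.
  - by move=> w; exact: sqr_ge0.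
  - exact: measurable_funM.
  - by move=> w; apply: mulr_ge0 => //; exact: mulrn_wge0.
  have -> : E (fun w => (N n w - n%:R * p) ^+ 2 + n%:R * p *+ 2 * N n w) =
      E (fun w => N n w ^+ 2 + (n%:R * p) ^+ 2).
    by apply: eq_integral => w _; congr _%:E; ring.
  rewrite ge0_expectationD//; last 2 first.
  - by move=> w; exact: sqr_ge0.
  - by move=> w; exact: sqr_ge0.
  rewrite ge0_expectation_cst (le_trans (leeD (EN2 n) (lexx _)))//.
  rewrite ge0_expectationM ?EN ?mulrn_wge0// -?EFinM -!EFinD lee_fin.
  by rewrite le_eqVlt; apply/orP; left; apply/eqP; ring.
by rewrite leeD2rE.
Qed.

(* With N the number of sample points in A, the U-statistic is 'C(N, v) / 'C(n, v),
   which is close to (N / n) ^ v; the L1 error of N / n is bounded through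
   |y| <= eta + y ^ 2 / eta and the variance. *)
Lemma L1_consistent_all (v : nat) : L1_consistent P X v (fun s => kernel s).
Proof.
split => [//|e e0]; have [p0 p1] := andP p01.
have -> : fine (E (fun w => kernel (mkseq (X ^~ w) v))) = p ^+ v.
  by rewrite Eall ?iota_uniq// size_iota.
(* The final bound is [v] times three contributions [eta]; the [+ 1] covers [v = 0]. *)
set eta := e / (3 * (v%:R + 1)).
have eta0 : 0 < eta by rewrite divr_gt0// mulr_gt0// ltr_wpDl.
near=> n.
have vn : (v < n)%N by near: n; exact: nbhs_infty_gt.
have nR : 0 < n%:R :> R by rewrite ltr0n (leq_ltn_trans _ vn).
(* [n1] makes the variance term [n / (n ^ 2 eta)] at most [eta], and [n2] does the same for
   [v / (n - v)]. *)
have n1 : (eta ^+ 2)^-1 <= n%:R by near: n; exact: nbhs_infty_ger.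
have n2 : v%:R / eta + v%:R <= n%:R by near: n; exact: nbhs_infty_ger.
have nv : 0 < (n - v)%:R :> R by rewrite ltr0n subn_gt0.
pose B w := v%:R * ((n%:R ^+ 2 * eta)^-1 * (N n w - n%:R * p) ^+ 2 + (eta + eta)).
have msq : measurable_fun setT (fun w => (N n w - n%:R * p) ^+ 2).
  by apply: measurable_funX; exact: measurable_funB.
have c0 : 0 <= (n%:R ^+ 2 * eta)^-1 by rewrite invr_ge0 mulr_ge0 ?sqr_ge0// ltW.
have mc : measurable_fun setT (fun w => (n%:R ^+ 2 * eta)^-1 * (N n w - n%:R * p) ^+ 2).
  exact: measurable_funM.
have ge0c w : 0 <= (n%:R ^+ 2 * eta)^-1 * (N n w - n%:R * p) ^+ 2.
  by rewrite mulr_ge0// sqr_ge0.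
apply: (@le_trans _ _ (E B)).
  apply: ge0_expectation_le => //.
  - apply: measurableT_comp => //; apply: measurable_funB => //.
    by apply: measurable_U_stat => t; exact: measurable_all.
  - by apply: measurable_funM => //; exact: measurable_funD.
  move=> w; rewrite U_statE sum_ltn_seqs_all mulrC /B.
  set k := (\sum_(i < n) A (X i w))%N.
  have -> : N n w = k%:R by rewrite /k natr_sum.
  have kn : (k <= n)%N.
    by rewrite -[leqRHS]card_ord -sum1_card; apply: leq_sum => i _; exact: leq_b1.
  rewrite (le_trans (binomial_ratio_power _ _ _ _ _ vn kn p01))//.
  rewrite ler_wpM2l// addrA lerD//; last first.
    rewrite ler_pdivrMr// natrB ?(ltnW vn)// mulrC -ler_pdivrMr//.
    by rewrite lerBrDr.
  have -> : k%:R / n%:R - p = (k%:R - n%:R * p) / n%:R by field; exact: lt0r_neq0.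
  set y := k%:R - n%:R * p.
  have -> : (n%:R ^+ 2 * eta)^-1 * y ^+ 2 = `|y / n%:R| ^+ 2 / eta.
    rewrite -normrX ger0_norm ?sqr_ge0//; field.
    by apply/andP; split; exact: lt0r_neq0.
  move: `|y / n%:R| (normr_ge0 (y / n%:R)) => z z0.
  rewrite -(ler_pM2r eta0) mulrDl divfK ?lt0r_neq0//.
  by nra.
rewrite ge0_expectationM//; last 2 first.
- exact: measurable_funD.
- by move=> w; rewrite addr_ge0// addr_ge0// ltW.
rewrite ge0_expectationD//; last by move=> w; rewrite addr_ge0// ltW.
rewrite ge0_expectation_cst ge0_expectationM//; last by move=> w; exact: sqr_ge0.
have le1 : (((n%:R ^+ 2 * eta)^-1)%:E * E (fun w => (N n w - n%:R * p) ^+ 2) <= eta%:E)%E.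
  apply: (le_trans (lee_wpmul2l _ (variance_le n))); first by rewrite lee_fin.
  rewrite -EFinM lee_fin.
  rewrite mulrC ler_pdivrMr; last by rewrite mulr_gt0// exprn_gt0.
  move: n1; rewrite -[X in X <= _]mul1r ler_pdivrMr ?exprn_gt0// => n1.
  by nra.
apply: (le_trans (lee_wpmul2l _ (leeD le1 (lexx _)))); first by rewrite lee_fin.
rewrite -EFinD -EFinM lee_fin (_ : eta + (eta + eta) = 3 * eta); last by ring.
have etaE : eta * (3 * (v%:R + 1)) = e by rewrite divfK// gt_eqF// mulr_gt0// ltr_wpDl.
by rewrite -etaE; nra.
Unshelve. all: by end_near. Qed.

End indicator_kernel.

(** * Extrema of finite sequences and rounding to a grid *)

Section extrema.
Variable R : realType.
Implicit Types (s : seq R) (a c : R).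

Lemma bigmax_seq_mem a s : \big[Num.max/a]_(y <- s) y \in a :: s.
Proof.
elim: s => [|x s IH]; first by rewrite big_nil inE.
rewrite big_cons /Num.max; case: ifP => _; last by rewrite !inE eqxx orbT.
by move: IH; rewrite !inE => /orP[->//|->]; rewrite !orbT.
Qed.

Lemma bigmin_seq_mem a s : \big[Num.min/a]_(y <- s) y \in a :: s.
Proof.
elim: s => [|x s IH]; first by rewrite big_nil inE.
rewrite big_cons /Num.min; case: ifP => _; first by rewrite !inE eqxx orbT.
by move: IH; rewrite !inE => /orP[->//|->]; rewrite !orbT.
Qed.

Lemma lt_bigmax_seq c a s :
  (c < \big[Num.max/a]_(y <- s) y) = has (fun y => c < y) (a :: s).
Proof.
elim: s => [|x s IH]; first by rewrite big_nil /= orbF.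
by rewrite big_cons lt_max IH /= orbCA.
Qed.

Lemma lt_bigmin_seq c a s :
  (c < \big[Num.min/a]_(y <- s) y) = all (fun y => c < y) (a :: s).
Proof.
elim: s => [|x s IH]; first by rewrite big_nil /= andbT.
by rewrite big_cons lt_min IH /= andbCA.
Qed.

Lemma seq_max_mem s : s != [::] -> seq_max s \in s.
Proof.
case: s => // x s _; have := bigmax_seq_mem x (x :: s).
by rewrite /seq_max /= !inE orbA orbb.
Qed.

Lemma seq_min_mem s : s != [::] -> seq_min s \in s.
Proof.
case: s => // x s _; have := bigmin_seq_mem x (x :: s).
by rewrite /seq_min /= !inE orbA orbb.
Qed.

(** The right-hand side has the shape of the [all A] kernels, so the indicator of [c < seq_max s] is
    one minus such a kernel. On the empty sequence the default [0] would break this for negative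
    [c]. *)
Lemma lt_seq_max c s : s != [::] -> (c < seq_max s) = ~~ all (fun y => y <= c) s.
Proof.
case: s => // x s _; rewrite /seq_max lt_bigmax_seq /= orbA orbb negb_and -ltNge.
by rewrite -has_predC; congr (_ || _); apply: eq_has => y; rewrite /= ltNge.
Qed.

Lemma lt_seq_min c s : s != [::] -> (c < seq_min s) = all (fun y => c < y) s.
Proof. by case: s => // x s _; rewrite /seq_min lt_bigmin_seq /= andbA andbb. Qed.

Lemma le_seq_max s x : x \in s -> x <= seq_max s.
Proof.
move=> xs; have s0 : s != [::] by case: s xs.
by have := lt_seq_max (seq_max s) s s0; rewrite ltxx => /esym/negbFE/allP; exact.
Qed.

(* With delta > 0 and K large this rounds x up to a multiple of delta. *)
Definition staircase (delta : R) (K : nat) (x : R) : R :=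
  \sum_(k < K) delta * (k%:R * delta < x)%R%:R.

Lemma staircase_ge0 (delta : R) K x : 0 <= delta -> 0 <= staircase delta K x.
Proof. by move=> d0; apply: sumr_ge0 => k _; rewrite mulr_ge0. Qed.

Lemma staircase_bounds (delta x : R) K : 0 < delta -> 0 <= x ->
  staircase delta K x <= x + delta /\ (x <= K%:R * delta -> x <= staircase delta K x).
Proof.
(* The third clause strengthens the induction: beyond the grid all [K] steps are counted, which
   fixes the value before the next step is added. *)
move=> d0 x0; suff : [/\ staircase delta K x <= x + delta,
    x <= K%:R * delta -> x <= staircase delta K x &
    K%:R * delta < x -> staircase delta K x = K%:R * delta] by case.
elim: K => [|K [IH1 IH2 IH3]].
  by rewrite /staircase big_ord0 mul0r addr_ge0// ltW.
have -> : staircase delta K.+1 x = staircase delta K x + delta * (K%:R * delta < x)%R%:R.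
  by rewrite /staircase big_ord_recr.
rewrite -natr1 mulrDl mul1r; have [Kx|xK] := ltP (K%:R * delta) x.
  by rewrite (IH3 Kx) mulr1; split => // ; lra.
rewrite mulr0 addr0; split => //; first by move=> _; exact: IH2.
by move=> ?; exfalso; lra.
Qed.

Lemma measurable_staircase (delta : R) K : measurable_fun setT (staircase delta K).
Proof.
apply: measurable_sum => k; apply: measurable_funM => //.
rewrite (_ : (fun _ => _) = \1_`]k%:R * delta, +oo[); first exact: measurable_indic.
by apply/funext => x; rewrite indicE mem_setE in_itv/= andbT.
Qed.

End extrema.

(** * Kernels that select an entry of the sample *)

Section selection_kernel.
Context d (T : measurableType d) (R : realType) (P : probability T R).
Variable X : nat -> T -> R.
Hypothesis iX : forall i, P.-integrable setT (EFin \o X i).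
Local Notation E f := (\int[P]_w (f w)%:E)%E.

Let mX i : measurable_fun setT (X i).
Proof. by apply/measurable_EFinP; exact: measurable_int (iX i). Qed.

Let norm_selection_le (m : seq R -> R) (f : R -> R) (s : seq R) :
  (forall s, s != [::] -> m s \in s) -> (forall x, 0 <= f x) ->
  s != [::] -> f (m s) <= \sum_(x <- s) f x.
Proof.
move=> mem f0 s0; rewrite (big_rem _ (mem _ s0))/= lerDl.
by apply: sumr_ge0.
Qed.

(** The selected entry is bounded by the sum of the absolute values of all entries; on the empty
    index sequence the kernel is constant. *)
Lemma integrable_selection (m : seq R -> R) :
  (forall s, s != [::] -> m s \in s) ->
  (forall t, measurable_fun setT (fun w => m [seq X i w | i <- t])) ->
  forall t, P.-integrable setT (EFin \o (fun w => m [seq X i w | i <- t])).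
Proof.
move=> mem mm [|i t]; first exact: (finite_measure_integrable_cst P (m [::])).
apply: (@le_integrable _ _ _ _ _ _ _
    (fun w => \sum_(j <- i :: t) (`|X j w|)%:E)%E) => //.
- exact/measurable_EFinP.
- move=> w _; rewrite /= sumEFin lee_fin.
  rewrite [leRHS]ger0_norm; last by apply: sumr_ge0.
  have := norm_selection_le m Num.norm [seq X j w | j <- i :: t] mem (fun=> normr_ge0 _) isT.
  by rewrite big_map.
- by apply: integrable_sum => // j _; exact: (integrable_abse (iX j)).
Qed.

(* A kernel m picking an entry of the sample satisfies
   |m s - staircase (m s)| <= \sum_(x <- s) |x - staircase x|, since the left-hand
   side is one of the summands; and staircase (m s) is a linear combination of
   the indicators of c < m s. *)
Lemma L1_consistent_selection (v : nat) (m : seq R -> R) : (0 < v)%N ->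
  (forall s, s != [::] -> m s \in s) ->
  (forall t, measurable_fun setT (fun w => m [seq X i w | i <- t])) ->
  (forall c, exists2 h, L1_consistent P X v h &
     forall s, s != [::] -> h s = (c < m s)%R%:R) ->
  (forall e, 0 < e -> exists delta K, forall i,
     (E (fun w => `|X i w - staircase R delta K (X i w)|) <= e%:E)%E) ->
  L1_consistent P X v m.
Proof.
move=> v0 mem mm /(_ _)/cid2 hex stair; apply: L1_consistent_approx => [|e e0].
  exact: integrable_selection.
pose h c := s2val (hex c).
have hP c : L1_consistent P X v (h c) /\ forall s, s != [::] -> h c s = (c < m s)%R%:R.
  by split; [exact: (s2valP (hex c))|exact: (s2valP' (hex c))].
(* The rounding errors of the [v] entries are added up, so each gets the share [e / v]. *)
have ev0 : 0 < e / v%:R by rewrite divr_gt0// ltr0n.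
have [delta [K XK]] := stair _ ev0.
exists (fun s => \sum_(k < K) delta * h (k%:R * delta) s) => [|t tv].
  elim: K {XK} => [|K IH].
    (* The empty sum is the zero kernel, obtained as the difference of a consistent kernel with
       itself. *)
    have [c0 _] := hP 0; have := L1_consistentDM _ _ _ _ _ _ _ _ (-1) c0 c0.
    by congr L1_consistent; apply/funext => s; rewrite big_ord0 mulN1r subrr.
  have [cK _] := hP (K%:R * delta).
  have := L1_consistentDM _ _ _ _ _ _ _ _ delta IH cK.
  by congr L1_consistent; apply/funext => s; rewrite big_ord_recr.
have mD i : measurable_fun setT (fun w => `|X i w - staircase R delta K (X i w)|).
  apply: measurableT_comp => //; apply: measurable_funB => //.
  by apply: measurableT_comp => //; exact: measurable_staircase.
have t0 w : [seq X i w | i <- t] != [::] by rewrite -size_eq0 size_map tv -lt0n.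
have hE w : \sum_(k < K) delta * h (k%:R * delta) [seq X i w | i <- t] =
    staircase R delta K (m [seq X i w | i <- t]).
  by apply: eq_bigr => k _; rewrite (hP _).2.
apply: (@le_trans _ _ (E (fun w => \sum_(i <- t) `|X i w - staircase R delta K (X i w)|))).
  apply: ge0_expectation_le => //.
  - apply: measurableT_comp => //; apply: measurable_funB => //.
    under eq_fun do rewrite hE.
    by apply: measurableT_comp => //; exact: measurable_staircase.
  - exact: measurable_sum.
  - move=> w; rewrite hE.
    have := norm_selection_le m (fun x => `|x - staircase R delta K x|) _ mem
      (fun=> normr_ge0 _) (t0 w).
    by rewrite big_map.
rewrite ge0_expectation_sum//.
apply: (@le_trans _ _ (\sum_(i <- t) (e / v%:R)%:E)%E); first by apply: lee_sum => i _; exact: XK.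
rewrite sumEFin lee_fin big_const_seq count_predT tv iter_addr_0 -[leLHS]mulr_natr.
by rewrite divfK// pnatr_eq0 -lt0n.
Qed.

Lemma measurable_seq_max (t : seq nat) :
  measurable_fun setT (fun w => seq_max [seq X i w | i <- t]).
Proof.
case: t => [|i t].
  by rewrite /seq_max; under eq_fun do rewrite big_nil; exact: measurable_cst.
(* The starting value [X i w] is detached from the list so that the induction can run on the list
   alone. *)
suff H t' : measurable_fun setT
    (fun w => \big[Num.max/X i w]_(y <- [seq X j w | j <- t']) y).
  exact: (H (i :: t)).
elim: t' => [|j t' IH]; first by under eq_fun do rewrite big_nil; exact: mX.
by under eq_fun do rewrite big_cons; exact: measurable_maxr.
Qed.

Lemma measurable_seq_min (t : seq nat) :
  measurable_fun setT (fun w => seq_min [seq X i w | i <- t]).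
Proof.
case: t => [|i t].
  by rewrite /seq_min; under eq_fun do rewrite big_nil; exact: measurable_cst.
suff H t' : measurable_fun setT
    (fun w => \big[Num.min/X i w]_(y <- [seq X j w | j <- t']) y).
  exact: (H (i :: t)).
elim: t' => [|j t' IH]; first by under eq_fun do rewrite big_nil; exact: mX.
by under eq_fun do rewrite big_cons; exact: measurable_minr.
Qed.

End selection_kernel.

(** * Equality in law, rounding errors in L1, and independence *)

(** The half-lines []-oo, r]] are stable under intersection, generate the Borel sets and exhaust the
    line, so a finite measure is determined by its values on them. *)
Lemma eq_cdf_distribution (R : realType) d1 (T1 : measurableType d1) (P1 : probability T1 R)
    d2 (T2 : measurableType d2) (P2 : probability T2 R)
    (X1 : {RV P1 >-> R}) (X2 : {RV P2 >-> R}) :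
  (forall r, cdf X1 r = cdf X2 r) ->
  forall A, measurable A -> distribution P1 X1 A = distribution P2 X2 A.
Proof.
move=> eqX; pose G : set (set R) := [set A | exists r, A = `]-oo, r]%classic].
apply: (measure_unique G (fun n => `]-oo, n%:R]%classic)).
- rewrite [LHS](RGenOInfty.measurableE R) eqEsubset; split => A.
    apply: smallest_sub; first exact: smallest_sigma_algebra.
    move=> _ [r ->]; rewrite -setCitvl; apply: (@measurableC _ (g_sigma_algebraType G)).
    by apply: sub_sigma_algebra; exists r.
  apply: smallest_sub; first exact: smallest_sigma_algebra.
  move=> _ [r ->]; rewrite -setCitvr.
  apply: measurableC.
  by apply: sub_sigma_algebra; exists r.
- move=> _ _ [r ->] [s ->]; exists (Num.min r s).
  by apply/seteqP; split => x /=; rewrite !in_itv/= le_min; [move=> [-> ->]|move=> /andP].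
- by move=> n; exists n%:R.
- rewrite -subTset => x _; exists (Num.truncn `|x|).+1 => //=.
  by rewrite in_itv/= (le_trans (ler_norm _))// ltW// truncnS_gt.
- by move=> _ [r ->]; exact: eqX.
- by move=> n; rewrite (le_lt_trans (probability_le1 _ _)) ?ltry.
Qed.

(** This carries moments and rounding errors from the reference variable to each observation: both
    integrals are taken against the same law. *)
Lemma eq_cdf_expectation (R : realType) d1 (T1 : measurableType d1) (P1 : probability T1 R)
    d2 (T2 : measurableType d2) (P2 : probability T2 R)
    (X1 : {RV P1 >-> R}) (X2 : {RV P2 >-> R}) (f : R -> \bar R) :
  (forall r, cdf X1 r = cdf X2 r) ->
  measurable_fun setT f -> (forall x, 0 <= f x)%E ->
  (\int[P1]_w f (X1 w) = \int[P2]_w f (X2 w))%E.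
Proof.
move=> eqX mf f0.
rewrite -[LHS](ge0_integral_distribution X1 mf f0).
rewrite -[RHS](ge0_integral_distribution X2 mf f0).
by apply: eq_measure_integral => A mA _; exact: eq_cdf_distribution.
Qed.

(** Dominated convergence along grids whose mesh tends to [0] while their range tends to infinity.
    The mesh is at most [1], so the error is dominated by the absolute value of [X] plus [1]. *)
Lemma staircase_approx (R : realType) d (T : measurableType d) (P : probability T R)
    (X : T -> R) (e : R) :
  P.-integrable setT (EFin \o X) -> {ae P, forall w, 0 <= X w} -> 0 < e ->
  exists delta K, (\int[P]_w `|X w - staircase R delta K (X w)|%:E <= e%:E)%E.
Proof.
move=> iX X0 e0.
have mX : measurable_fun setT X by apply/measurable_EFinP; exact: measurable_int iX.
(* With mesh [1 / (n + 1)], [(n + 1) ^ 2] steps reach up to [n + 1]. *)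
pose f n w := `|X w - staircase R n.+1%:R^-1 (n.+1 ^ 2) (X w)|.
have mf n : measurable_fun setT (f n).
  apply: measurableT_comp => //; apply: measurable_funB => //.
  by apply: measurableT_comp => //; exact: measurable_staircase.
have d0 n : 0 < n.+1%:R^-1 :> R by rewrite invr_gt0.
have [_ _] : [/\ P.-integrable setT (cst 0%E : T -> \bar R),
    [sequence \int[P]_w `|(f n w)%:E - 0|]_n @ \oo --> 0%E &
    [sequence \int[P]_w (f n w)%:E]_n @ \oo --> \int[P]_w (cst 0%E : T -> \bar R) w]%E.
  apply: (@dominated_convergence _ _ _ P _ measurableT (fun n w => (f n w)%:E)
    (cst 0%E) (fun w => (`|X w| + 1)%:E)) => //.
  - by move=> n; exact/measurable_EFinP.
  - apply: filterS X0 => w Xw _; apply: cvg_EFin; first by near=> n.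
    apply/cvgrPdist_le => /= eps eps0; near=> n.
    have [le1 le2] := staircase_bounds R n.+1%:R^-1 (X w) (n.+1 ^ 2) (d0 n) Xw.
    have {}le2 : X w <= staircase R n.+1%:R^-1 (n.+1 ^ 2) (X w).
      apply: le2; rewrite natrX expr2 mulfK ?pnatr_eq0//.
      by rewrite (@le_trans _ _ n%:R) ?ler_nat//; near: n; exact: nbhs_infty_ger.
    rewrite sub0r normrN /f normr_id ler0_norm ?subr_le0// opprB lerBlDl.
    rewrite (le_trans le1)// lerD2l invf_ple ?posrE//.
    by rewrite (@le_trans _ _ n%:R) ?ler_nat//; near: n; exact: nbhs_infty_ger.
  - under eq_fun do rewrite EFinD.
    apply: integrableD => //; first exact: (integrable_abse iX).
    exact: finite_measure_integrable_cst.
  - apply: filterS X0 => w Xw n _; rewrite lee_fin normr_id.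
    have [le1 _] := staircase_bounds R n.+1%:R^-1 (X w) (n.+1 ^ 2) (d0 n) Xw.
    have ge0 := staircase_ge0 R n.+1%:R^-1 (n.+1 ^ 2) (X w) (ltW (d0 n)).
    have le1' : n.+1%:R^-1 <= 1 :> R by rewrite invf_le1// ler1n.
    rewrite /f (ger0_norm Xw) ler_norml.
    move: Xw le1 ge0 le1'; set S := staircase _ _ _ _; set D := _^-1.
    by move=> *; apply/andP; split; lra.
rewrite integral0 => /fine_cvgP[fin /cvgrPdist_le/(_ _ e0) cvg].
near \oo => n; exists n.+1%:R^-1, (n.+1 ^ 2)%N.
have finn : (\int[P]_w (f n w)%:E \is a fin_num)%E by near: n.
rewrite -(fineK finn) lee_fin (le_trans (ler_norm _))//.
rewrite -normrN -sub0r; near: n; exact: cvg.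
Unshelve. all: by end_near. Qed.

(** The kernel is the indicator of an intersection of events over the indices in [t]. As these are
    distinct, the finite set they form has [size t] elements, which gives the exponent. *)
Lemma mutually_independent_expectation_all (R : realType) d (T : measurableType d)
    (P : probability T R) (X : nat -> {RV P >-> R}) (A : pred R) (p : R) :
  mutually_independent X -> measurable [set x | A x] ->
  (forall i, P (X i @^-1` [set x | A x]) = p%:E) ->
  forall t : seq nat, uniq t ->
  (\int[P]_w ((all A [seq X i w | i <- t])%:R)%:E = (p ^+ size t)%:E)%E.
Proof.
move=> indX mA PA t ut.
have := indX [fset i in t]%fset (fun=> [set x | A x]) (fun _ _ => mA).
under eq_bigr do rewrite PA.
rewrite prodEFin big_const_seq count_predT -[size _]/(#|` [fset i in t]%fset|).
rewrite card_fseq undup_id// iter_mulr_1 => <-.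
set B := \bigcap_(i in _) _.
have mB : measurable B.
  apply: bigcap_measurableType => i _.
  by rewrite -[X in measurable X]setTI; exact: measurable_funP.
rewrite -[B in RHS]setIT -integral_indic//.
apply: eq_integral => w _; congr _%:E; rewrite indicE; congr (nat_of_bool _)%:R.
apply/idP/idP => [/allP h|].
  rewrite inE => i /=; rewrite !inE => it.
  by apply: h; apply/mapP; exists i.
rewrite inE => h; apply/allP => _ /mapP[i it ->].
by apply: h; rewrite /= !inE.
Qed.

(** * Convergence in probability of a quotient *)

(** Over the common denominator [z * b] the numerator is [(y - a) * b - a * (z - b)]. The condition
    [eta <= b / 2] keeps [z] above [b / 2], hence the denominator above [b ^+ 2 / 2]. *)
Lemma ratioB_le (R : realFieldType) (y z a b e eta : R) :
  0 < b -> 0 < eta -> eta <= b / 2 -> (b + `|a|) * eta <= e * (b ^+ 2 / 2) ->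
  `|y - a| <= eta -> `|z - b| <= eta -> `|y / z - a / b| <= e.
Proof.
move=> b0 eta0 etab etae ya zb.
have bz : b / 2 <= z by move: zb; rewrite ler_distlC => /andP[]; lra.
have z0 : 0 < z by apply: lt_le_trans bz; rewrite divr_gt0.
have -> : y / z - a / b = ((y - a) * b - a * (z - b)) / (z * b).
  by field; rewrite !gt_eqF.
rewrite normrM [X in _ * X]ger0_norm; last by rewrite invr_ge0 mulr_ge0// ltW.
rewrite ler_pdivrMr ?mulr_gt0//.
have num : `|(y - a) * b - a * (z - b)| <= (b + `|a|) * eta.
  rewrite (le_trans (ler_normB _ _))// !normrM (gtr0_norm b0) mulrDl.
  by rewrite lerD// ?[b * _]mulrC ?ler_wpM2r ?ler_wpM2l// ltW.
have e0 : 0 <= e.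
  have : 0 <= e * (b ^+ 2 / 2) by rewrite (le_trans _ etae)// mulr_ge0 ?addr_ge0// ltW.
  by rewrite pmulr_lge0// divr_gt0// exprn_gt0.
rewrite (le_trans num)// (le_trans etae)// ler_wpM2l//.
by nra.
Qed.

(** Markov's inequality: if the quotient is off by more than [e], then the errors of numerator and
    denominator add up to at least some fixed [eta], and their expectations tend to [0]. *)
Lemma cvg_in_probability_ratio (R : realType) d (T : measurableType d)
    (P : probability T R) (Y Z : nat -> T -> R) (a b : R) :
  (forall n, measurable_fun setT (Y n)) -> (forall n, measurable_fun setT (Z n)) ->
  0 < b ->
  (forall e, 0 < e -> \forall n \near \oo, (\int[P]_w `|Y n w - a|%:E <= e%:E)%E) ->
  (forall e, 0 < e -> \forall n \near \oo, (\int[P]_w `|Z n w - b|%:E <= e%:E)%E) ->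
  cvg_in_probability P (fun n w => Y n w / Z n w) (a / b).
Proof.
move=> mY mZ b0 Ya Zb e e0.
pose B n := [set w | e < `|Y n w / Z n w - a / b|].
have ltE y z : z != 0 -> (e < `|y / z - a / b|) = (e * `|z| < `|y - a / b * z|).
  by move=> z0; rewrite -[in RHS](divfK z0 y) -mulrBl normrM ltr_pM2r ?normr_gt0.
have mB n : measurable (B n).
  (* Measurability is obtained by clearing the denominator where [Z n] is nonzero; where it vanishes
     the quotient is [0] by convention, and the condition no longer depends on [w]. *)
  have -> : B n = (Z n @^-1` [set 0] `&` [set _ | e < `|a / b|]) `|`
      (Z n @^-1` (~` [set 0]) `&`
       (fun w => `|Y n w - a / b * Z n w| - e * `|Z n w|) @^-1` `]0, +oo[).
    apply/seteqP; rewrite /B; split => w /=; rewrite in_itv/= andbT subr_gt0.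
      have [->|z0] := eqVneq (Z n w) 0; first by rewrite invr0 mulr0 sub0r normrN; left.
      by rewrite ltE//; move=> ?; right; split => //; exact/eqP.
    case=> [[-> ?]|[/eqP z0 ?]]; first by rewrite invr0 mulr0 sub0r normrN.
    by rewrite ltE.
  apply: measurableU; apply: measurableI.
  - by rewrite -[X in measurable X]setTI; exact: mZ.
  - have -> : [set _ : T | e < `|a / b|] = if e < `|a / b| then setT else set0.
      by case: ifP => h; apply/seteqP; split.
    by case: ifP.
  - by rewrite -[X in measurable X]setTI; apply: mZ => //; exact: measurableC.
  - rewrite -[X in measurable X]setTI; apply: (_ : measurable_fun setT _) => //.
    apply: measurable_funB; last by apply: measurable_funM => //; exact: measurableT_comp.
    apply: measurableT_comp => //; apply: measurable_funB => //.
    exact: measurable_funM.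
(* The two arguments of the minimum are the two smallness conditions of [ratioB_le]. *)
pose eta := Num.min (b / 2) (e * (b ^+ 2 / 2) / (b + `|a|)).
have ba0 : 0 < b + `|a| by rewrite ltr_pwDl.
have eta0 : 0 < eta by rewrite lt_min !divr_gt0//= !mulr_gt0// invr_gt0.
have eta1 : eta <= b / 2 by rewrite ge_min lexx.
have eta2 : (b + `|a|) * eta <= e * (b ^+ 2 / 2).
  by rewrite mulrC -ler_pdivlMr// ge_min lexx orbT.
apply/fine_cvgP; split; first by apply: nearW => n; apply: fin_num_measure; exact: mB.
apply/cvgrPdist_le => /= eps eps0.
have eps1 : 0 < eta * (eps / 2) by rewrite mulr_gt0// divr_gt0.
near=> n; rewrite sub0r normrN ger0_norm; last by rewrite fine_ge0.
rewrite -lee_fin fineK -/(B n); last by apply: fin_num_measure; exact: mB.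
have En1 : (\int[P]_w `|Y n w - a|%:E <= (eta * (eps / 2))%:E)%E.
  by near: n; exact: (Ya _ eps1).
have En2 : (\int[P]_w `|Z n w - b|%:E <= (eta * (eps / 2))%:E)%E.
  by near: n; exact: (Zb _ eps1).
have mYa : measurable_fun setT (fun w => `|Y n w - a|).
  by apply: measurableT_comp => //; exact: measurable_funB.
have mZb : measurable_fun setT (fun w => `|Z n w - b|).
  by apply: measurableT_comp => //; exact: measurable_funB.
have mYZ : measurable_fun setT (fun w => `|Y n w - a| + `|Z n w - b|).
  exact: measurable_funD.
rewrite -[B n]setIT -integral_indic//.
apply: (@le_trans _ _ (\int[P]_w (eta^-1 * (`|Y n w - a| + `|Z n w - b|))%:E)%E).
  apply: (ge0_expectation_le _ _ _ P (\1_(B n))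
    (fun w => eta^-1 * (`|Y n w - a| + `|Z n w - b|))) => //.
  - exact: measurable_funM.
  - move=> w; rewrite indicE; have [|_] := boolP (w \in B n); last first.
      by rewrite mulr_ge0 ?invr_ge0 ?addr_ge0// ltW.
    rewrite inE /B /= => Bw; rewrite mulrC ler_pdivlMr// mul1r leNgt.
    apply/negP => lt; move: Bw; rewrite ltNge => /negP; apply.
    have Y0 := normr_ge0 (Y n w - a); have Z0 := normr_ge0 (Z n w - b).
    by apply: (ratioB_le _ _ _ _ _ _ eta) => //; lra.
rewrite (ge0_expectationM _ _ _ P eta^-1 (fun w => `|Y n w - a| + `|Z n w - b|))//; last first.
  by rewrite invr_ge0 ltW.
rewrite (ge0_expectationD _ _ _ P (fun w => `|Y n w - a|) (fun w => `|Z n w - b|))//.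
apply: (le_trans (lee_wpmul2l _ (leeD En1 En2))); first by rewrite lee_fin invr_ge0 ltW.
rewrite -EFinD -EFinM lee_fin -mulrDr -splitr mulrA mulVf ?mul1r// gt_eqF//.
Unshelve. all: by end_near. Qed.

(** * Non-degeneracy, and the application to the extrema *)

(** The distribution function of a constant jumps from [0] to [1] at [c]. The single interval from
    [c - delta / 2] to [c] is shorter than [delta] but has increment [1], against absolute
    continuity with tolerance [1]. *)
Lemma not_degenerate_absolutely_continuous_cdf (R : realType) (F : R -> R)
    d (T : measurableType d) (P : probability T R) (X : {RV P >-> R}) (c : R) :
  absolutely_continuous F -> (forall r, cdf X r = (F r)%:E) ->
  ~ {ae P, forall w, X w = c}.
Proof.
move=> /(_ 1 ltr01)[delta delta0 ac] XF Xc.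
have mle r : measurable (X @^-1` `]-oo, r]).
  by rewrite -[X in measurable X]setTI; exact: measurable_funP.
have F1 : F c = 1.
  apply: EFin_inj; rewrite -XF /cdf /distribution /pushforward.
  have : P (~` (X @^-1` `]-oo, c])) = 0%E.
    apply: measure_negligible; first exact: measurableC.
    apply: negligibleS Xc => w /=; rewrite in_itv/= => h Xw.
    by apply: h; rewrite Xw.
  rewrite probability_setC// => /eqP; rewrite sube_eq ?fin_num_measure//.
  by rewrite add0e => /eqP.
have F0 r : r < c -> F r = 0.
  move=> rc; apply: EFin_inj; rewrite -XF /cdf /distribution /pushforward.
  apply: measure_negligible => //.
  apply: negligibleS Xc => w /=; rewrite in_itv/= => h Xw.
  by move: h; rewrite Xw leNgt rc.
have := ac 1%N (fun=> c - delta / 2) (fun=> c).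
rewrite !big_ord1 F1 F0 ?subr0 ?normr1 ?ltxx; last by rewrite ltrBlDr ltrDl divr_gt0.
move=> h; suff : false by []; apply: h.
- by move=> _; rewrite lerBlDr lerDl divr_ge0// ltW.
- by move=> i j _ _ _; rewrite !ord1.
- by rewrite opprB addrC subrK; lra.
Qed.

Theorem corollary1 (R : realType) (v : nat) (hv : (1 < v)%N)
    (F : R -> R) (F_ac : absolutely_continuous F)
    (d0 : measure_display) (T0 : measurableType d0) (P0 : probability T0 R)
    (X0 : {RV P0 >-> R})
    (X0_F : forall r : R, cdf X0 r = (F r)%:E)
    (X0_ge0 : {ae P0, forall w, 0 <= X0 w})
    (X0_mean : ('E_P0[X0] < +oo)%E)
    (d : measure_display) (T : measurableType d) (P : probability T R)
    (X : nat -> {RV P >-> R})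
    (X_indep : mutually_independent X)
    (X_F : forall (i : nat) (r : R), cdf (X i) r = (F r)%:E) :
  cvg_in_probability P (fun (n : nat) (w : T) => GIM_hat v n (fun i => X i w))
    (GIM v X).
Proof.
have v0 : (0 < v)%N by exact: ltnW.
have eqX i r : cdf (X i) r = cdf X0 r by rewrite X_F X0_F.
have mX0 : measurable_fun setT X0 by exact: measurable_funP.
(* Almost sure non-negativity identifies the mean with the first absolute moment, so a finite mean
   gives integrability. *)
have normX0 : (\int[P0]_w `|X0 w|%:E = 'E_P0[X0])%E.
  rewrite unlock; apply: ae_eq_integral => //.
  - by apply/measurable_EFinP; exact: measurableT_comp.
  - exact/measurable_EFinP.
  - by apply: filterS X0_ge0 => w Xw _; rewrite ger0_norm.
have iX0 : P0.-integrable setT (EFin \o X0).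
  apply/integrableP; split; first exact/measurable_EFinP.
  by rewrite (le_lt_trans _ X0_mean)// -normX0.
have normX i : (\int[P]_w `|X i w|%:E = \int[P0]_w `|X0 w|%:E)%E.
  apply: (eq_cdf_expectation _ _ _ _ _ _ _ (X i) X0 (fun x => `|x|%:E)) => //.
  by apply/measurable_EFinP; exact: normr_measurable.
have iX i : P.-integrable setT (EFin \o X i).
  apply/integrableP; split; first by apply/measurable_EFinP; exact: measurable_funP.
  by rewrite (le_lt_trans _ X0_mean)// -normX0 -(normX i).
(* One grid serves all observations, as the expected rounding error depends only on the common
   law. *)
have stair e : 0 < e -> exists delta K, forall i,
    (\int[P]_w `|X i w - staircase R delta K (X i w)|%:E <= e%:E)%E.
  move=> e0; have [delta [K le]] := staircase_approx _ _ _ _ _ _ iX0 X0_ge0 e0.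
  exists delta, K => i; apply: le_trans le.
  rewrite (eq_cdf_expectation _ _ _ _ _ _ _ (X i) X0 (fun x => `|x - staircase R delta K x|%:E))//.
  apply/measurable_EFinP; apply: measurableT_comp => //; apply: measurable_funB => //.
  exact: measurable_staircase.
have mXi i : measurable_fun setT (X i) by exact: measurable_funP.
have consA (A : pred R) p : measurable [set x | A x] -> (forall i, P (X i @^-1` [set x | A x]) = p%:E) ->
    L1_consistent P X v (fun s => (all A s)%:R).
  move=> mA PA; apply: (L1_consistent_all _ _ _ _ _ _ p) => //.
  exact: mutually_independent_expectation_all.
have P_le c i : P (X i @^-1` [set x | x <= c]) = (F c)%:E.
  by rewrite -(X_F i) /cdf /distribution /pushforward set_itvNyc.
have m_le (c : R) : measurable [set x | x <= c] by rewrite -set_itvNyc; exact: measurable_itv.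
have cons_max : L1_consistent P X v (@seq_max R).
  apply: L1_consistent_selection => //.
  - exact: seq_max_mem.
  - exact: measurable_seq_max.
  (* The constant [1] is written as the indicator kernel of the whole line, with probability [1], so
     that it too is covered by [consA]. *)
  - move=> c; exists (fun s => (all predT s)%:R + (-1) * (all (fun y => y <= c) s)%:R).
      apply: L1_consistentDM; last exact: (consA _ (F c)).
      have setTE : [set x : R | predT x] = setT by apply/seteqP; split.
      by apply: (consA _ 1) => [|i]; rewrite setTE// preimage_setT probability_setT.
    move=> s s0; rewrite all_predT lt_seq_max//.
    by case: all => /=; rewrite ?mulr1n; ring.
have cons_min : L1_consistent P X v (@seq_min R).
  apply: L1_consistent_selection => //.
  - exact: seq_min_mem.
  - exact: measurable_seq_min.
  - move=> c; exists (fun s => (all (fun y => c < y) s)%:R).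
      apply: (consA _ (1 - F c)) => [|i].
        by rewrite -set_itvoy; exact: measurable_itv.
      rewrite (_ : [set x | c < x] = ~` [set x | x <= c]).
        rewrite preimage_setC probability_setC ?P_le//.
        by rewrite -[X in measurable X]setTI; exact: (mXi i measurableT _ (m_le c)).
      by apply/seteqP; split => x /=; rewrite ltNge => /negP.
    by move=> s s0; rewrite lt_seq_min.
have [im cm] : L1_consistent P X v (@max_minus_min R).
  rewrite (_ : @max_minus_min R = fun s => seq_max s + (-1) * seq_min s).
    exact: L1_consistentDM.
  by apply/funext => s; rewrite mulN1r.
have [ip cp] : L1_consistent P X v (@max_plus_min R).
  rewrite (_ : @max_plus_min R = fun s => seq_max s + 1 * seq_min s).
    exact: L1_consistentDM.
  by apply/funext => s; rewrite mul1r.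
rewrite /GIM unlock.
apply: (cvg_in_probability_ratio _ _ _ P
  (fun n w => U_stat v (@max_minus_min R) n (X ^~ w))
  (fun n w => U_stat v (@max_plus_min R) n (X ^~ w))) => //.
- by move=> n; apply: measurable_U_stat => t; apply/measurable_EFinP; exact: measurable_int (im t).
- by move=> n; apply: measurable_U_stat => t; apply/measurable_EFinP; exact: measurable_int (ip t).
(* It remains to show that the limit of the denominator is positive. Non-negativity is transferred
   by the law to each observation, then to all at once by countability. *)
have X_ge0 : {ae P, forall w, forall i, 0 <= X i w}.
  apply: ae_foralln => i.
  have mneg : measurable [set x : R | x < 0] by rewrite -set_itvNyo; exact: measurable_itv.
  have neg0 : P (X i @^-1` [set x | x < 0]) = 0%E.
    have -> : P (X i @^-1` [set x | x < 0]) = P0 (X0 @^-1` [set x | x < 0]).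
      exact: (eq_cdf_distribution _ _ _ _ _ _ _ (X i) X0 (eqX i) _ mneg).
    apply: measure_negligible.
      by rewrite -[X in measurable X]setTI; exact: (mX0 measurableT _ mneg).
    by apply: negligibleS X0_ge0 => w /=; rewrite ltNge => /negP.
  exists (X i @^-1` [set x | x < 0]); split => //.
    by rewrite -[X in measurable X]setTI; exact: (mXi i measurableT _ mneg).
  by move=> w /= /negP; rewrite -ltNge.
(* A vanishing first absolute moment would make [X0] almost surely [0], which absolute continuity
   excludes. *)
have EX0 : (0 < \int[P0]_w `|X0 w|%:E)%E.
  rewrite lt0e integral_ge0 ?andbT; last by move=> w _; rewrite lee_fin.
  apply/eqP.
  have -> : (\int[P0]_w `|X0 w|%:E = \int[P0]_w `|(EFin \o X0) w|)%E by [].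
  move=> /(ae_eq_integral_abs _ _) h.
  have {}h := h measurableT ((measurable_EFinP _ _).2 mX0).
  apply: (not_degenerate_absolutely_continuous_cdf R F _ _ _ X0 0 F_ac X0_F).
  by apply: filterS h => w /(_ I) [].
rewrite fine_gt0//; apply/andP; split; last first.
  by rewrite ltey_eq integrable_fin_num//; exact: (ip (iota 0 v)).
have mplus : measurable_fun setT (fun w => max_plus_min (mkseq (X ^~ w) v)).
  by apply/measurable_EFinP; exact: measurable_int (ip (iota 0 v)).
(* With a non-negative minimum, maximum plus minimum is at least the first observation, so its
   expectation is at least that of [X0]. *)
have ge_X0 : {ae P, forall w, 0 <= X 0%N w <= max_plus_min (mkseq (X ^~ w) v)}.
  apply: filterS X_ge0 => w Xw; rewrite Xw/=.
  have X0_mem : X 0%N w \in mkseq (X ^~ w) v by apply/mapP; exists 0%N; rewrite ?mem_iota.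
  rewrite -[leLHS]addr0 lerD ?le_seq_max//.
  have /seq_min_mem/mapP[i _ ->] // : mkseq (X ^~ w) v != [::].
  by rewrite -size_eq0 size_mkseq -lt0n.
rewrite (lt_le_trans EX0)// -(normX 0%N).
(* The absolute value makes the integrand non-negative everywhere and changes it only on a null
   set. *)
rewrite [leRHS](_ : _ = \int[P]_w `|max_plus_min (mkseq (X ^~ w) v)|%:E)%E.
  apply: ae_ge0_le_integral => //.
  - by apply/measurable_EFinP; exact: measurableT_comp.
  - by apply/measurable_EFinP; exact: measurableT_comp.
  - apply: filterS ge_X0 => w /andP[Xw XS] _; rewrite lee_fin.
    by rewrite !ger0_norm// (le_trans Xw).
apply: ae_eq_integral => //.
- exact/measurable_EFinP.
- by apply/measurable_EFinP; exact: measurableT_comp.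
- by apply: filterS ge_X0 => w /andP[Xw XS] _; rewrite ger0_norm// (le_trans Xw).
Qed.
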